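(* Let $E$ be a nonempty set, $\mathcal{L}$ a semialgebra of subsets of $E$, $\eta:\mathcal{L}\to[0,\infty)$ a finitely additive measure and $b\in[0,\infty)$. Let $n,N\in\mathbb{N}$ (positive integers), $\pi_1,\dots,\pi_n\in B(E,\mathcal{L})$, $s_1,\dots,s_N\in B(E,\mathcal{L})$, let $Y$ be a nonempty subset of $\mathbb{R}^N$ and let $J\subset\{1,\dots,N\}$. Assume that (i) $s_j\in B_0(E,\mathcal{L})$ for every $j\in J$; (ii) $Y$ is closed in $\mathbb{R}^N$ (usual topology). Then $$\mathbf{as}[M;\Pi;\mathfrak{Y}]=\mathbf{as}[M;\Pi;\widehat{\mathfrak{Y}}[J]]=\mathbf{sas}[M;\Pi;\mathfrak{Y}]=\mathbf{sas}[M;\Pi;\widehat{\mathfrak{Y}}[J]]=\widetilde{\Pi}\bigl(\widetilde{S}^{-1}(Y)\bigr),$$ where $\widetilde{\Pi}(\widetilde{S}^{-1}(Y))=\{\widetilde\Pi(\mu):\mu\in\Xi,\ \widetilde S(\mu)\in Y\}\subset\mathbb{R}^n$.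
   Context: Semialgebra: $\mathcal{L}$ is a family of subsets of $E$ with $\varnothing,E\in\mathcal{L}$, closed under pairwise intersections, and such that for every $\Lambda\in\mathcal{L}$ the set $E\setminus\Lambda$ is a union of finitely many ($\geq 1$) pairwise disjoint members of $\mathcal{L}$. Finitely additive measure: a function $\mu:\mathcal{L}\to\mathbb{R}$ with $\mu(L)=\sum_{i=1}^m\mu(L_i)$ whenever $L,L_1,\dots,L_m\in\mathcal{L}$, the $L_i$ are pairwise disjoint and $L=\bigcup_i L_i$. $(\mathrm{add})^+[\mathcal{L};\eta]$ is the set of all nonnegative finitely additive measures $\mu$ on $\mathcal{L}$ such that $\eta(L)=0\Rightarrow\mu(L)=0$ for all $L\in\mathcal{L}$. Step functions: $B_0(E,\mathcal{L})$ is the set of all functions $\sum_{i=1}^m\alpha_i\chi_{L_i}:E\to\mathbb{R}$ with $m\in\mathbb{N}$, $\alpha_i\in\mathbb{R}$ and $L_1,\dots,L_m\in\mathcal{L}$ pairwise disjoint with union $E$ ($\chi_L$ is the indicator of $L$). $B(E,\mathcal{L})$ is the set of bounded functions $E\to\mathbb{R}$ that are uniform limits of sequences from $B_0(E,\mathcal{L})$; it is closed under products. $B_0^+(E,\mathcal{L})$ is the set of nonnegative elements of $B_0(E,\mathcal{L})$. Integral: for a nonnegative finitely additive measure $\mu$ and a step function $f=\sum_{i=1}^m\alpha_i\chi_{L_i}\in B_0(E,\mathcal{L})$, where $m\in\mathbb{N}$, $\alpha_i\in\mathbb{R}$ and $L_1,\dots,L_m\in\mathcal{L}$ are pairwise disjoint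 with union $E$, $\int_E f\,d\mu=\sum_{i=1}^m\alpha_i\mu(L_i)$; for $f\in B(E,\mathcal{L})$, $\int_E f\,d\mu=\lim_k\int_E f_k\,d\mu$ for any sequence $f_k\in B_0(E,\mathcal{L})$ converging uniformly to $f$ (this is well defined). Sets of ordinary and generalized controls: $$M=\Bigl\{f\in B_0^+(E,\mathcal{L}):\int_E f\,d\eta=b\Bigr\},\qquad \Xi=\{\mu\in(\mathrm{add})^+[\mathcal{L};\eta]:\mu(E)=b\}.$$ Maps: $\Pi:M\to\mathbb{R}^n$, $\Pi(f)=\bigl(\int_E\pi_i f\,d\eta\bigr)_{i=1}^n$; $S:M\to\mathbb{R}^N$, $S(f)=\bigl(\int_E s_jf\,d\eta\bigr)_{j=1}^N$; $\widetilde\Pi:\Xi\to\mathbb{R}^n$, $\widetilde\Pi(\mu)=\bigl(\int_E\pi_i\,d\mu\bigr)_{i=1}^n$; $\widetilde S:\Xi\to\mathbb{R}^N$, $\widetilde S(\mu)=\bigl(\int_E s_j\,d\mu\bigr)_{j=1}^N$. Relaxed constraints: for $\varepsilon>0$, $$\mathbb{O}_N(Y,\varepsilon)=\{z\in\mathbb{R}^N:\exists y\in Y,\ \max_{1\le j\le N}|y_j-z_j|<\varepsilon\},$$ $$\widehat{\mathbb{O}}_N(Y,\varepsilon|J)=\{z\in\mathbb{R}^N:\exists y\in Y,\ y_j=z_j\ \forall j\in J,\ |y_j-z_j|<\varepsilon\ \forall j\in\{1,\dots,N\}\setminus J\},$$ and $\mathfrak{Y}=\{S^{-1}(\mathbb{O}_N(Y,\varepsilon)):\varepsilon>0\}$,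 $\widehat{\mathfrak{Y}}[J]=\{S^{-1}(\widehat{\mathbb{O}}_N(Y,\varepsilon|J)):\varepsilon>0\}$ (families of subsets of $M$). Attraction sets: for a nonempty family $\mathcal{X}$ of subsets of $M$, $\mathbf{as}[M;\Pi;\mathcal{X}]$ is the set of all $x\in\mathbb{R}^n$ for which there is a net $g:D\to M$ on a nonempty directed set $(D,\preceq)$ such that (1) for every $\Sigma\in\mathcal{X}$ there is $d\in D$ with $g(\delta)\in\Sigma$ for all $\delta\succeq d$, and (2) the net $\Pi\circ g$ converges to $x$ in the usual topology of $\mathbb{R}^n$. $\mathbf{sas}[M;\Pi;\mathcal{X}]$ is defined in the same way with sequences $(f_i)_{i\in\mathbb{N}}$ in $M$ instead of nets. *)

(* Defs.v *)
From mathcomp Require Import all_boot all_order all_algebra.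
From mathcomp Require Import all_classical all_reals all_analysis.

Set Implicit Arguments.
Unset Strict Implicit.
Unset Printing Implicit Defensive.
Import Order.TTheory GRing.Theory Num.Theory.
Import numFieldNormedType.Exports.
Local Open Scope classical_set_scope.
Local Open Scope ring_scope.

(* Standing conventions.
   - A set function on a family L of subsets of E is a total map set E -> R;
     only its values on members of L are ever constrained or used.
   - R^n is the space of row vectors 'rV[R]_n with its product topology. *)

Section Semialgebra.
Context {R : realType} {E : Type}.
Implicit Types (L : set (set E)) (mu : set E -> R) (A : set E) (f : E -> R).

(* A is the union of the m >= 1 pairwise disjoint members F i of L. *)
Definition disjoint_union L A m (F : 'I_m -> set E) : Prop :=
  [/\ (0 < m)%N, forall i, L (F i), trivIset setT F & \bigcup_i F i = A].

Record semialgebra L : Prop := Semialgebra {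
  semialgebra0 : L set0 ;
  semialgebraT : L setT ;
  semialgebraI : setI_closed L ;
  semialgebraC : forall A, L A ->
    exists m (F : 'I_m -> set E), disjoint_union L (~` A) F }.

Definition finitely_additive L mu : Prop :=
  forall A m (F : 'I_m -> set E), L A -> disjoint_union L A F ->
    mu A = \sum_(i < m) mu (F i).

Definition nonneg_measure L mu : Prop :=
  finitely_additive L mu /\ forall A, L A -> 0 <= mu A.

Definition addp L (eta : set E -> R) : set (set E -> R) :=
  [set mu : set E -> R | nonneg_measure L mu /\
    forall A, L A -> eta A = 0 -> mu A = 0].

(* f = \sum_i alpha_i chi_(F i), with the F i in L partitioning E. *)
Definition step_repr L f m (alpha : 'I_m -> R) (F : 'I_m -> set E) : Prop :=
  disjoint_union L setT F /\
  forall x, f x = \sum_(i < m) alpha i * \1_(F i) x.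

Definition B0 L : set (E -> R) :=
  [set f : E -> R | exists m (alpha : 'I_m -> R) (F : 'I_m -> set E),
    step_repr L f alpha F].

Definition B0p L : set (E -> R) :=
  [set f : E -> R | B0 L f /\ forall x, 0 <= f x].

Definition uniform_limit (f_ : nat -> E -> R) f : Prop :=
  forall e : R, 0 < e -> \forall k \near \oo, forall x, `|f_ k x - f x| < e.

Definition B L : set (E -> R) :=
  [set f : E -> R | bounded_fun f /\
    exists f_ : nat -> E -> R, (forall k, B0 L (f_ k)) /\ uniform_limit f_ f].

(* For mu in nonneg_measure L and L a semialgebra, the value below does not
   depend on the representation of f in B0 L; outside B0 L it is 0. *)
Definition step_integral L mu f : R :=
  xget 0 [set v : R | exists m (alpha : 'I_m -> R) (F : 'I_m -> set E),
    step_repr L f alpha F /\ v = \sum_(i < m) alpha i * mu (F i)].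

(* Likewise, for f in B L the limit does not depend on the approximating
   sequence; outside the uniform closure of B0 L the value is 0. *)
Definition integral L mu f : R :=
  xget 0 [set v : R | exists f_ : nat -> E -> R,
    [/\ forall k, B0 L (f_ k), uniform_limit f_ f &
        step_integral L mu (f_ k) @[k --> \oo] --> v]].

End Semialgebra.

Section Controls.
Context {R : realType} {E : Type}.
Variables (L : set (set E)) (eta : set E -> R) (b : R).

Definition ordinary_controls : set (E -> R) :=
  [set f : E -> R | B0p L f /\ step_integral L eta f = b].

Definition generalized_controls : set (set E -> R) :=
  [set mu : set E -> R | addp L eta mu /\ mu setT = b].

(* f |-> (\int_E g_i f d eta)_i and mu |-> (\int_E g_i d mu)_i; these give
   Pi and tilde Pi for g = pi, and S and tilde S for g = s. *)
Definition density_map n (g : 'I_n -> E -> R) (f : E -> R) : 'rV[R]_n :=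
  \row_i integral L eta (fun x => g i x * f x).

Definition measure_map n (g : 'I_n -> E -> R) (mu : set E -> R) : 'rV[R]_n :=
  \row_i integral L mu (g i).

End Controls.

Section Relaxation.
Context {R : realType} {N : nat}.
Implicit Types (Y : set 'rV[R]_N) (J : {set 'I_N}).

(* The seed 0 of the maximum is immaterial, since N >= 1 is assumed. *)
Definition ON Y (e : R) : set 'rV[R]_N :=
  [set z : 'rV[R]_N | exists2 y, Y y &
    \big[Num.max/0]_(j < N) `|y 0 j - z 0 j| < e].

Definition ONhat Y (e : R) J : set 'rV[R]_N :=
  [set z : 'rV[R]_N | exists y, [/\ Y y, forall j, j \in J -> y 0 j = z 0 j &
    forall j, j \notin J -> `|y 0 j - z 0 j| < e]].

Context {T : Type}.
Variables (M : set T) (S : T -> 'rV[R]_N).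

Definition relaxed Y : set (set T) :=
  [set M `&` S @^-1` ON Y e | e in [set e : R | 0 < e]].

Definition relaxed_hat Y J : set (set T) :=
  [set M `&` S @^-1` ONhat Y e J | e in [set e : R | 0 < e]].

End Relaxation.

Section Attraction.
Context {T : Type} {V : topologicalType}.
Variables (M : set T) (Pi : T -> V) (X : set (set T)).

Record directed_order (D : Type) (le : D -> D -> Prop) : Prop := DirectedOrder {
  directed_inhabited : inhabited D ;
  directed_refl : forall d, le d d ;
  directed_trans : forall d1 d2 d3, le d1 d2 -> le d2 d3 -> le d1 d3 ;
  directed_ub : forall d1 d2, exists d3, le d1 d3 /\ le d2 d3 }.

(* Sets containing a tail {d' | le d d'}. *)
Definition tail_filter (D : Type) (le : D -> D -> Prop) : set_system D :=
  filter_from setT (fun d => [set d' | le d d']).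

Definition attraction_set : set V :=
  [set x : V | exists (D : Type) (le : D -> D -> Prop) (g : D -> T),
    [/\ directed_order le, forall d, M (g d),
        forall A, X A -> exists d, forall d', le d d' -> A (g d') &
        Pi (g d) @[d --> tail_filter le] --> x]].

Definition sequential_attraction_set : set V :=
  [set x : V | exists f_ : nat -> T,
    [/\ forall k, M (f_ k),
        forall A, X A -> exists k, forall k', (k <= k')%N -> A (f_ k') &
        Pi (f_ k) @[k --> \oo] --> x]].

End Attraction.

(* Main.v *)
Require Import Defs.
From mathcomp Require Import all_boot all_order all_algebra.
From mathcomp Require Import all_classical all_reals all_analysis.
From mathcomp Require Import ring lra.

(** A control f with eta-integral b is the density of a measure in Xi, and the
    integrals of g f against eta are, uniformly over the controls, close to
    those of h f when the step function h is close to g.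

    If x is attracted along the relaxed constraints, choose an ultrafilter on
    controls refining the net. The values on each A in L of the measures with
    these densities lie in [0, b], hence converge along the ultrafilter; the
    limit mu is in Xi, and for every g in B(E, L) the integrals of g f against
    eta converge to that of g against mu. So x is the image of mu, and
    closedness of Y puts the moments of mu in Y.

    Conversely, given mu in Xi and finitely many step functions, let f be
    mu(A) / eta(A) on each block A of a common partition: its density measure
    integrates these step functions exactly as mu does. Taking 1/k-approximants
    of the pi_i and s_j, and s_j itself for j in J, gives a sequence of controls
    satisfying the J-constraints exactly. *)

Import Order.TTheory GRing.Theory Num.Theory.
Import numFieldNormedType.Exports.
Local Open Scope classical_set_scope.
Local Open Scope ring_scope.
Set Implicit Arguments.
Unset Strict Implicit.
Unset Printing Implicit Defensive.

(** * Finite partitions and integrals of step functions *)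

Section StepFunctions.
Context {R : realType} {E : Type}.
Implicit Types (L : set (set E)) (mu : set E -> R) (A : set E) (f g h : E -> R).

(* A finite partition of E into members of L, indexed by I, is encoded by the
   map sending a point to the index of its block (blocks may be empty). *)
Definition block_map L (I : Type) (q : E -> I) : Prop :=
  forall i, L (q @^-1` [set i]).

Definition block_sum mu (I : finType) (q : E -> I) (a : I -> R) : R :=
  \sum_i a i * mu (q @^-1` [set i]).

(** The inhabitant of [I] guarantees the positive number of blocks that [disjoint_union] demands. *)
Lemma disjoint_union_preimage L A (I : finType) (q : E -> I) : I ->
  (forall i, L (A `&` q @^-1` [set i])) ->
  disjoint_union L A (fun k : 'I_#|I| => A `&` q @^-1` [set enum_val k]).
Proof.
move=> i0 Lq; split => //.
- by apply/card_gt0P; exists i0.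
- move=> i j _ _ [x [[_ qi] [_ qj]]].
  by apply: enum_val_inj; rewrite -qi -qj.
- apply/seteqP; split => [x [i _ []]//|x Ax].
  by exists (enum_rank (q x)) => //; split => //=; rewrite enum_rankK.
Qed.

Lemma finitely_additive_preimage L mu A (I : finType) (q : E -> I) : I ->
  finitely_additive L mu -> L A -> (forall i, L (A `&` q @^-1` [set i])) ->
  mu A = \sum_i mu (A `&` q @^-1` [set i]).
Proof.
move=> i0 mufa LA Lq.
rewrite (mufa _ _ _ LA (disjoint_union_preimage i0 Lq)).
by rewrite [RHS](reindex (@enum_val I I)) //; apply/onW_bij/enum_val_bij.
Qed.

Lemma finitely_additive0 L mu : finitely_additive L mu -> L set0 -> mu set0 = 0.
Proof.
move=> mufa L0.
(* The empty set is cut into two empty blocks, so its measure equals its own double. *)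
have := @finitely_additive_preimage L mu set0 bool (fun _ => true) true mufa L0.
rewrite big_bool !set0I => /(_ (fun i => _)) H.
have /eqP : mu set0 = mu set0 + mu set0 by apply: H => i; rewrite set0I.
by rewrite -subr_eq0 opprD addrA subrr sub0r oppr_eq0 => /eqP.
Qed.

(** Keeping the complement of A as the block [None] lets the lemma serve families that do not cover
    E, such as the pieces of the complement of a member of L. *)
Lemma disjoint_union_block_map L m (F : 'I_m -> set E) A :
  disjoint_union L A F -> exists q : E -> option 'I_m,
    (forall i, q @^-1` [set Some i] = F i) /\ q @^-1` [set None] = ~` A.
Proof.
case=> m0 LF tF UF.
exists (fun x => [pick i | `[< F i x >]]); split.
  move=> i; apply/seteqP; split => x /=.
    by case: pickP => // j /asboolP Fj [<-].
  move=> Fi; case: pickP => [j /asboolP Fj|/(_ i)/asboolP//].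
  by congr Some; apply: tF => //; exists x.
apply/seteqP; split => x /=.
  by case: pickP => // Fn _; rewrite -UF => -[i _ Fi]; have /asboolP := Fn i.
by move=> Ax; case: pickP => // j /asboolP Fj; case: Ax; rewrite -UF; exists j.
Qed.

Lemma step_repr_block_map L f m (alpha : 'I_m -> R) (F : 'I_m -> set E) :
  step_repr L f alpha F -> exists q : E -> 'I_m,
    (forall i, q @^-1` [set i] = F i) /\ forall x, f x = alpha (q x).
Proof.
case=> dF fE; have [m0 LF tF UF] := dF.
have [r [rF rN]] := disjoint_union_block_map dF.
pose q x := odflt (Ordinal m0) (r x).
have rS x : r x = Some (q x).
  rewrite /q; case rx : (r x) => [//|].
  have : (r @^-1` [set None]) x by [].
  by rewrite rN setCT.
have qF i : q @^-1` [set i] = F i.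
  rewrite -rF; apply/seteqP; split=> x /=; rewrite rS; first by move=> ->.
  by case.
exists q; split => // x.
rewrite fE (bigD1 (q x)) //= big1 ?addr0.
  by rewrite indicE mem_set ?mulr1 // -qF.
move=> i /eqP iq; rewrite indicE memNset ?mulr0 // -qF => qi.
by apply: iq; rewrite -qi.
Qed.

Context (x0 : E).

Lemma step_repr_preimage L f (I : finType) (q : E -> I) (a : I -> R) :
  block_map L q -> (forall x, f x = a (q x)) ->
  step_repr L f (fun k : 'I_#|I| => a (enum_val k))
    (fun k => q @^-1` [set enum_val k]).
Proof.
move=> Lq fE; split.
  have := @disjoint_union_preimage L setT I q (q x0).
  by under eq_fun do rewrite setTI; apply => i; rewrite setTI.
move=> x; rewrite (bigD1 (enum_rank (q x))) //= big1 ?addr0.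
  by rewrite indicE mem_set ?mulr1 /= enum_rankK.
move=> k /eqP kq; rewrite indicE memNset ?mulr0 //= => qk.
by apply: kq; rewrite qk enum_valK.
Qed.

Lemma B0P L f : B0 L f <-> exists (I : finType) (q : E -> I) (a : I -> R),
  block_map L q /\ forall x, f x = a (q x).
Proof.
split=> [[m [alpha [F rf]]]|[I [q [a [Lq fE]]]]].
  have [q [qF fE]] := step_repr_block_map rf.
  exists 'I_m, q, alpha; split => // i; rewrite qF.
  by case: rf => -[].
by do 3 eexists; exact: step_repr_preimage.
Qed.

Context (L : set (set E)) (HL : semialgebra L).

Lemma block_map_family (K : finType) (I : K -> finType)
    (q : forall k, E -> I k) : (forall k, block_map L (q k)) ->
  block_map L (fun x => [ffun k => q k x] : {dffun forall k, I k}).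
Proof.
move=> Lq i.
have -> : (fun x => [ffun k => q k x] : {dffun forall k, I k}) @^-1` [set i] =
    \big[setI/setT]_(k : K) (q k @^-1` [set i k]).
  rewrite -bigcap_seq; apply/seteqP; split => [x /= qx k _ /=|x /= qx].
    by rewrite -qx ffunE.
  by apply/ffunP => k; rewrite ffunE; apply: qx; rewrite /= mem_index_enum.
by apply: big_ind => [|A B LA LB|k _]; [exact: semialgebraT HL
  |exact: (semialgebraI HL)|exact: Lq].
Qed.

(** The common refinement, with tuples of block indices as indices, puts finitely many step
    functions on one partition, where they can be compared block by block. *)
Lemma B0_family (K : finType) (h : K -> E -> R) : (forall k, B0 L (h k)) ->
  exists (I : finType) (q : E -> I) (a : K -> I -> R),
    block_map L q /\ forall k x, h k x = a k (q x).
Proof.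
move=> Bh.
have H k : {I : finType & {q : E -> I & {a : I -> R |
    block_map L q /\ forall x, h k x = a (q x)}}}.
  have /cid[I /cid[q /cid[a Ha]]] := (B0P L (h k)).1 (Bh k).
  by exists I, q, a.
pose q k := projT1 (projT2 (H k)).
exists {dffun forall k, projT1 (H k)}, (fun x => [ffun k => q k x]).
exists (fun k (i : {dffun forall k, projT1 (H k)}) =>
  sval (projT2 (projT2 (H k))) (i k)); split.
  by apply: block_map_family => k; case: (svalP (projT2 (projT2 (H k)))).
by move=> k x; rewrite ffunE; case: (svalP (projT2 (projT2 (H k)))).
Qed.

Section Measure.
Context (mu : set E -> R) (mu_measure : nonneg_measure L mu).

Let mufa : finitely_additive L mu := mu_measure.1.

Lemma nonneg_measure0 : mu set0 = 0.
Proof. exact: finitely_additive0 mufa (semialgebra0 HL). Qed.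

(** Both sums expand over the intersections of blocks: a point of an intersection forces the two
    coefficients to agree, and an empty intersection has measure 0. This makes the step integral
    well defined. *)
Lemma eq_block_sum (I K : finType) (q : E -> I) (r : E -> K) a c :
  block_map L q -> block_map L r -> (forall x, a (q x) = c (r x)) ->
  block_sum mu q a = block_sum mu r c.
Proof.
move=> Lq Lr ac.
have LI i k : L (q @^-1` [set i] `&` r @^-1` [set k]).
  exact: (semialgebraI HL).
transitivity (\sum_i \sum_k a i * mu (q @^-1` [set i] `&` r @^-1` [set k])).
  apply: eq_bigr => i _; rewrite -mulr_sumr.
  by rewrite (@finitely_additive_preimage L mu _ _ r (r x0)).
rewrite exchange_big /=; apply: eq_bigr => k _.
rewrite (@finitely_additive_preimage L mu (r @^-1` [set k]) _ q (q x0)) //.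
  rewrite mulr_sumr; apply: eq_bigr => i _; rewrite [in RHS]setIC.
  have [/eqP->|/set0P[x [/= <- <-]]] := boolP
      ((q @^-1` [set i] `&` r @^-1` [set k]) == set0).
    by rewrite nonneg_measure0 !mulr0.
  by rewrite ac.
by move=> i; rewrite setIC.
Qed.

Lemma step_integralE f (I : finType) (q : E -> I) a :
  block_map L q -> (forall x, f x = a (q x)) ->
  step_integral L mu f = block_sum mu q a.
Proof.
move=> Lq fE; rewrite /step_integral; case: xgetP; last first.
  move=> /(_ (\sum_(k < #|I|) a (enum_val k) * mu (q @^-1` [set enum_val k]))).
  case; exists #|I|, (fun k => a (enum_val k)).
  exists (fun k => q @^-1` [set enum_val k]); split => //.
  exact: step_repr_preimage.
move=> _ _ [m [alpha [F [rf ->]]]].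
have [r [rF fE']] := step_repr_block_map rf.
transitivity (block_sum mu r alpha).
  by apply: eq_bigr => i _; rewrite rF.
apply: eq_block_sum => //; last by move=> x; rewrite -fE'.
by move=> i; rewrite rF; case: rf => -[].
Qed.

Lemma eq_step_integral f g : (forall x, f x = g x) ->
  step_integral L mu f = step_integral L mu g.
Proof. by move=> fg; congr step_integral; apply/funext. Qed.

Lemma le_step_integral f g : B0 L f -> B0 L g -> (forall x, f x <= g x) ->
  step_integral L mu f <= step_integral L mu g.
Proof.
move=> Bf Bg fg.
have [I [q [a [Lq aE]]]] := @B0_family bool (fun t => if t then f else g)
  (fun t => match t with true => Bf | false => Bg end).
rewrite (step_integralE Lq (aE true)) (step_integralE Lq (aE false)).
apply: ler_sum => i _.
(* On an empty block the coefficients need not be ordered, but its measure is 0. *)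
have [->|/set0P[x <-]] := eqVneq (q @^-1` [set i]) set0.
  by rewrite nonneg_measure0 !mulr0.
rewrite ler_wpM2r//; first by apply: mu_measure.2; exact: Lq.
by rewrite -(aE true) -(aE false) fg.
Qed.

Lemma step_integral_sum (K : finType) (c : K -> R) (h : K -> E -> R) :
  (forall k, B0 L (h k)) ->
  step_integral L mu (fun x => \sum_k c k * h k x) =
  \sum_k c k * step_integral L mu (h k).
Proof.
move=> /B0_family[I [q [a [Lq aE]]]].
rewrite (@step_integralE _ _ q (fun i => \sum_k c k * a k i)) //; last first.
  by move=> x; apply: eq_bigr => k _; rewrite aE.
under [RHS]eq_bigr do rewrite (step_integralE Lq (aE _)) mulr_sumr.
rewrite exchange_big; apply: eq_bigr => i _ /=.
by rewrite mulr_suml; apply: eq_bigr => k _; rewrite mulrA.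
Qed.

(** This shape covers differences and, with a zero coefficient, signed multiples. *)
Lemma step_integralZB u v f g : B0 L f -> B0 L g ->
  step_integral L mu (fun x => u * f x - v * g x) =
  u * step_integral L mu f - v * step_integral L mu g.
Proof.
move=> Bf Bg.
have := @step_integral_sum bool (fun t => if t then u else - v)
  (fun t => if t then f else g)
  (fun t => match t with true => Bf | false => Bg end).
rewrite big_bool /= mulNr => <-; apply: eq_step_integral => x.
by rewrite big_bool /= mulNr.
Qed.

End Measure.

Lemma B0_cst (c : R) : B0 L (fun=> c).
Proof.
apply/B0P; exists unit, (fun=> tt), (fun=> c); split => // -[].
by rewrite (_ : _ @^-1` _ = setT); [exact: semialgebraT HL|exact/seteqP].
Qed.

(** The pieces of the complement together with A itself, as block [None], partition E. *)
Lemma B0_indic A : L A -> B0 L (\1_A : E -> R).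
Proof.
move=> LA; have [m [F dF]] := semialgebraC HL LA.
have [q [qF qN]] := disjoint_union_block_map dF.
apply/B0P; exists (option 'I_m), q, (fun o => (o == None)%:R); split.
  by case=> [i|]; rewrite ?qF ?qN ?setCK //; case: dF.
move=> x; have -> : A = q @^-1` [set None] by rewrite qN setCK.
rewrite indicE; congr ((nat_of_bool _)%:R); apply/idP/eqP; first by rewrite inE.
by move=> qx; rewrite inE.
Qed.

Lemma B0_comp2 (op : R -> R -> R) f g : B0 L f -> B0 L g ->
  B0 L (fun x => op (f x) (g x)).
Proof.
move=> Bf Bg.
have [I [q [a [Lq aE]]]] := @B0_family bool (fun t => if t then f else g)
  (fun t => match t with true => Bf | false => Bg end).
apply/B0P; exists I, q, (fun i => op (a true i) (a false i)); split => // x.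
by rewrite -(aE true) -(aE false).
Qed.

Lemma B0_bounded f : B0 L f -> exists2 C : R, 0 <= C & forall x, `|f x| <= C.
Proof.
move=> /B0P[I [q [a [_ fE]]]]; exists (\sum_i `|a i|).
  by apply: sumr_ge0 => i _; exact: normr_ge0.
move=> x; rewrite fE (bigD1 (q x)) //= lerDl.
by apply: sumr_ge0 => i _; exact: normr_ge0.
Qed.

End StepFunctions.

(** * Integrals of uniform limits of step functions *)

Lemma ler_addMgt0 (R : realFieldType) (x y C : R) : 0 <= C ->
  (forall d, 0 < d -> x <= y + d * C) -> x <= y.
Proof.
move=> C0 H; apply/ler_addgt0Pr => e e0.
have C1 : 0 < C + 1 by rewrite ltr_wpDl.
have /H/le_trans : 0 < e / (C + 1) by rewrite divr_gt0.
apply; rewrite lerD2l -mulrA ler_piMr//; first exact: ltW.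
by rewrite mulrC ler_pdivrMr// mul1r lerDl.
Qed.

Section Integral.
Context {R : realType} {E : Type} (x0 : E).
Context (L : set (set E)) (HL : semialgebra L).
Implicit Types (A : set E) (f g h w : E -> R).

(** A form of approximation without sequences, suited to choosing a step function for a prescribed
    error. *)
Definition uniformly_approximable f : Prop :=
  forall e : R, 0 < e -> exists2 h, B0 L h & forall x, `|f x - h x| <= e.

Lemma B_uniformly_approximable f : B L f -> uniformly_approximable f.
Proof.
move=> [_ [f_ [Bf_ f_f]]] e e0; have [k _ /(_ k (leqnn k)) H] := f_f e e0.
by exists (f_ k) => // x; rewrite distrC ltW.
Qed.

Lemma B0_uniformly_approximable f : B0 L f -> uniformly_approximable f.
Proof. by move=> Bf e e0; exists f => // x; rewrite subrr normr0 ltW. Qed.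

Lemma B0M f g : B0 L f -> B0 L g -> B0 L (fun x => f x * g x).
Proof. exact: (B0_comp2 x0 HL (fun u v => u * v)). Qed.

(** This gives the integrand of [density_map] an integral when the weight is a control. *)
Lemma uniformly_approximableM f g : uniformly_approximable f -> B0 L g ->
  uniformly_approximable (fun x => f x * g x).
Proof.
move=> uf Bg e e0; have [C C0 gC] := B0_bounded x0 Bg.
have C1 : 0 < C + 1 by rewrite ltr_wpDl.
have [|h Bh fh] := uf (e / (C + 1)); first by rewrite divr_gt0.
exists (fun x => h x * g x); first exact: B0M.
move=> x; rewrite -mulrBl normrM -(divfK (lt0r_neq0 C1) e).
by rewrite ler_pM// (le_trans (gC x))// lerDl.
Qed.

Context (mu : set E -> R) (mu_measure : nonneg_measure L mu).

Let muT_ge0 : 0 <= mu setT.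
Proof. exact: mu_measure.2 (semialgebraT HL). Qed.

Lemma step_integral_cst c : step_integral L mu (fun=> c) = c * mu setT.
Proof.
rewrite (@step_integralE _ _ x0 _ HL _ mu_measure _ unit (fun=> tt)
  (fun=> c)) //.
  rewrite /block_sum (big_pred1 tt) => [|[]//].
  by congr (_ * mu _); exact/seteqP.
move=> []; rewrite (_ : _ @^-1` _ = setT); last exact/seteqP.
exact: semialgebraT HL.
Qed.

(** The pointwise bound |f w - g w| <= e w is integrated by monotonicity, once for each sign. *)
Lemma step_integral_weight_dist f g w e : B0 L f -> B0 L g -> B0 L w ->
  (forall x, 0 <= w x) -> (forall x, `|f x - g x| <= e) ->
  `|step_integral L mu (fun x => f x * w x) -
    step_integral L mu (fun x => g x * w x)| <= e * step_integral L mu w.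
Proof.
move=> Bf Bg Bw w0 fg.
have ZB := step_integralZB x0 HL mu_measure.
have B2 := @B0_comp2 R _ x0 _ HL.
have Bfw := B0M Bf Bw; have Bgw := B0M Bg Bw.
have Bd : B0 L (fun x => 1 * (f x * w x) - 1 * (g x * w x)).
  exact: (B2 (fun u v => 1 * u - 1 * v) _ _ _ _).
have key x : `|1 * (f x * w x) - 1 * (g x * w x)| <= e * w x.
  by rewrite !mul1r -mulrBl normrM (ger0_norm (w0 x)) ler_wpM2r.
rewrite -[step_integral L mu (fun x => f x * w x)]mul1r.
rewrite -[step_integral L mu (fun x => g x * w x)]mul1r -ZB//.
rewrite ler_norml; apply/andP; split.
  have -> : - (e * step_integral L mu w) =
      step_integral L mu (fun x => 0 * w x - e * w x).
    by rewrite ZB// mul0r sub0r.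
  apply: (le_step_integral x0 HL mu_measure) => //.
    exact: (B2 (fun u v => 0 * u - e * v) _ _ _ _).
  by move=> x; rewrite mul0r sub0r; move: (key x); rewrite ler_norml => /andP[].
have -> : e * step_integral L mu w =
    step_integral L mu (fun x => e * w x - 0 * w x).
  by rewrite ZB// mul0r subr0.
apply: (le_step_integral x0 HL mu_measure) => //.
  exact: (B2 (fun u v => e * u - 0 * v) _ _ _ _).
by move=> x; rewrite mul0r subr0; move: (key x); rewrite ler_norml => /andP[].
Qed.

Lemma step_integral_dist f g e : B0 L f -> B0 L g ->
  (forall x, `|f x - g x| <= e) ->
  `|step_integral L mu f - step_integral L mu g| <= e * mu setT.
Proof.
move=> Bf Bg fg.
have := @step_integral_weight_dist f g (fun=> 1) e Bf Bg (B0_cst x0 HL 1).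
rewrite step_integral_cst mul1r.
under eq_fun do rewrite mulr1.
under [X in _ - step_integral _ _ X]eq_fun do rewrite mulr1.
by apply.
Qed.

(** Uniformly close step functions have close integrals, so the integrals of approximants form a
    Cauchy sequence; hence [xget] has a value to pick. *)
Lemma integral_cvg f : uniformly_approximable f -> exists f_ : nat -> E -> R,
  [/\ forall k, B0 L (f_ k), uniform_limit f_ f &
      step_integral L mu (f_ k) @[k --> \oo] --> Defs.integral L mu f].
Proof.
move=> uf.
suff [v Hv] : exists v : R, exists f_ : nat -> E -> R,
    [/\ forall k, B0 L (f_ k), uniform_limit f_ f &
        step_integral L mu (f_ k) @[k --> \oo] --> v].
  by rewrite /Defs.integral; case: xgetP => [w _ //|/(_ v)/(_ Hv)].
have /choice[f_ Hf] k : exists h, B0 L h /\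
    forall x, `|f x - h x| <= k.+1%:R^-1.
  by have [|h Bh fh] := uf k.+1%:R^-1; [rewrite invr_gt0|exists h].
have ff : uniform_limit f_ f.
  move=> e e0; near=> k => x.
  rewrite distrC (le_lt_trans ((Hf k).2 x))//.
  by near: k; exact: near_infty_natSinv_lt (PosNum e0).
suff /cvg_ex[v fv] : cvgn (fun k => step_integral L mu (f_ k)).
  by exists v, f_; split => // k; exact: (Hf k).1.
apply/cauchy_cvgP/cauchy_exP => e e0.
(* Two terms from K on differ by at most e / (mu(E) + 1), so their integrals by less than e; the + 1
   covers mu(E) = 0. *)
have m0 : 0 < 2 * (mu setT + 1) by rewrite mulr_gt0// ltr_wpDl.
have [K _ HK] := ff (e / (2 * (mu setT + 1))) (divr_gt0 e0 m0).
exists (step_integral L mu (f_ K)); exists K => // k /= Kk.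
rewrite /ball /=.
apply: (@le_lt_trans _ _
  ((e / (2 * (mu setT + 1)) + e / (2 * (mu setT + 1))) * mu setT)).
  apply: step_integral_dist; [exact: (Hf K).1|exact: (Hf k).1|move=> x].
  rewrite (le_trans (ler_distD (f x) _ _))// lerD//.
    exact/ltW/HK/leqnn.
  by rewrite distrC; exact/ltW/HK.
have m1 : 0 < mu setT + 1 by rewrite ltr_wpDl.
have -> : e / (2 * (mu setT + 1)) + e / (2 * (mu setT + 1)) = e / (mu setT + 1).
  by field; rewrite lt0r_neq0.
by rewrite -mulrA gtr_pMr// mulrC ltr_pdivrMr// mul1r ltrDl.
Unshelve. all: end_near. Qed.

Lemma integral_step_dist f h e : uniformly_approximable f -> B0 L h ->
  (forall x, `|f x - h x| <= e) ->
  `|Defs.integral L mu f - step_integral L mu h| <= e * mu setT.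
Proof.
move=> /integral_cvg[f_ [Bf ff cf]] Bh fh.
(* The slack splits into d for the convergence of the step integrals and d mu(E) for the uniform
   error of the approximants. *)
apply: (@ler_addMgt0 _ _ _ (mu setT + 1)); first by rewrite addr_ge0.
move=> d d0.
have /cvgrPdist_le/(_ d d0) ck := cf.
near \oo => k.
rewrite (le_trans (ler_distD (step_integral L mu (f_ k)) _ _))//.
have -> : e * mu setT + d * (mu setT + 1) = d + (d + e) * mu setT by ring.
apply: lerD; first by near: k.
apply: step_integral_dist => // x.
rewrite (le_trans (ler_distD (f x) _ _))// lerD//.
apply/ltW; move: x; near: k; exact: ff.
Unshelve. all: end_near. Qed.

(** Here f is its own approximant, with error 0. *)
Lemma integral_step f : B0 L f -> Defs.integral L mu f = step_integral L mu f.
Proof.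
move=> Bf; apply/eqP; rewrite -subr_eq0 -normr_le0 -(mul0r (mu setT)).
apply: integral_step_dist => //; first exact: B0_uniformly_approximable.
by move=> x; rewrite subrr normr0.
Qed.

(* The bound involves only the integral of the weight f, not its supremum:
   this makes it uniform over the ordinary controls. *)
Lemma integral_weight_step_dist f g h e : B0 L f -> (forall x, 0 <= f x) ->
  uniformly_approximable g -> B0 L h -> (forall x, `|g x - h x| <= e) ->
  `|Defs.integral L mu (fun x => g x * f x) -
    step_integral L mu (fun x => h x * f x)| <= e * step_integral L mu f.
Proof.
move=> Bf f0 ug Bh gh; have [C C0 fC] := B0_bounded x0 Bf.
have if0 : 0 <= step_integral L mu f.
  rewrite -(mul0r (mu setT)) -step_integral_cst.
  by apply: (le_step_integral x0 HL mu_measure) => //; exact: B0_cst.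
(* An auxiliary step function h' within d of g absorbs the bound C of f into a term that vanishes
   with d; passing from h' to h costs (d + e) times the integral of f. *)
apply: (@ler_addMgt0 _ _ _ (C * mu setT + step_integral L mu f)).
  by rewrite addr_ge0// mulr_ge0.
move=> d d0; have [h' Bh' gh'] := ug d d0.
rewrite (le_trans (ler_distD (step_integral L mu (fun x => h' x * f x)) _ _))//.
rewrite mulrDr addrCA mulrA -mulrDl lerD//.
  apply: integral_step_dist; [exact: uniformly_approximableM|exact: B0M|].
  by move=> x; rewrite -mulrBl normrM ler_pM.
apply: step_integral_weight_dist => // x.
by rewrite (le_trans (ler_distD (g x) _ _))// addrC lerD// distrC.
Qed.

End Integral.

(** * Ordinary controls approximating a generalized one *)

Section Controls.
Context {R : realType} {E : Type} (x0 : E).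
Context (L : set (set E)) (HL : semialgebra L).
Context (eta : set E -> R) (eta_measure : nonneg_measure L eta).
Context (b : R).
Implicit Types (A : set E) (f g h w : E -> R) (mu : set E -> R).

Local Notation M := (ordinary_controls L eta b).
Local Notation Xi := (generalized_controls L eta b).

(** Replacing g by h costs e b in each integral, since f has eta-integral b and mu has total mass
    b. *)
Lemma integral_density_dist f mu g h e : M f -> Xi mu ->
  uniformly_approximable L g -> B0 L h -> (forall x, `|g x - h x| <= e) ->
  `|Defs.integral L eta (fun x => g x * f x) - Defs.integral L mu g| <=
  `|step_integral L eta (fun x => h x * f x) - step_integral L mu h| +
  e * (2 * b).
Proof.
move=> [[Bf f0] fb] [[mu_measure _] mub] ug Bh gh.
have := integral_weight_step_dist x0 HL eta_measure Bf f0 ug Bh gh.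
have := integral_step_dist x0 HL mu_measure ug Bh gh.
rewrite mub fb => H1 H2.
have H3 := ler_distD (step_integral L eta (fun x => h x * f x))
  (Defs.integral L eta (fun x => g x * f x)) (Defs.integral L mu g).
have H4 := ler_distD (step_integral L mu h)
  (step_integral L eta (fun x => h x * f x)) (Defs.integral L mu g).
by rewrite distrC in H1; lra.
Qed.

(* The density on a block is the ratio of the two measures; on a block of zero
   eta-measure x / 0 = 0 is harmless, since mu vanishes there as well. *)
Lemma exact_density mu (K : finType) (h : K -> E -> R) : Xi mu ->
  (forall k, B0 L (h k)) -> exists2 f, M f &
    forall k, step_integral L eta (fun x => h k x * f x) =
              step_integral L mu (h k).
Proof.
move=> [[mu_measure mu_eta] mub] /(B0_family x0 HL)[I [q [a [Lq aE]]]].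
pose r i := mu (q @^-1` [set i]) / eta (q @^-1` [set i]).
have rK i : r i * eta (q @^-1` [set i]) = mu (q @^-1` [set i]).
  have [e0|e0] := eqVneq (eta (q @^-1` [set i])) 0.
    by rewrite e0 mulr0 mu_eta.
  by rewrite divfK.
have step_ratio c g : (forall x, g x = c (q x) * r (q x)) ->
    step_integral L eta g = block_sum mu q c.
  move=> gE; rewrite (step_integralE (a := fun i => c i * r i) x0 HL
    eta_measure Lq gE).
  by apply: eq_bigr => i _; rewrite -mulrA rK.
exists (fun x => r (q x)).
  split; [split|].
  - by apply/(B0P x0); exists I, q, r.
  - move=> x; apply: divr_ge0; [exact: mu_measure.2|exact: eta_measure.2].
  (* The coefficient 1 yields the total mass of mu, which is b. *)
  - rewrite (step_ratio (fun=> 1)) => [|x]; last by rewrite mul1r.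
    rewrite -mub -[RHS]mul1r -(step_integral_cst x0 HL mu_measure).
    by rewrite (step_integralE x0 HL mu_measure Lq (a := fun=> 1)).
move=> k; rewrite (step_ratio (a k)); last by move=> x; rewrite aE.
by rewrite (step_integralE x0 HL mu_measure Lq (aE k)).
Qed.

Lemma approximate_density mu (K : finType) (P : pred K) (g : K -> E -> R) e :
  Xi mu -> (forall k, uniformly_approximable L (g k)) ->
  (forall k, P k -> B0 L (g k)) -> 0 < e ->
  exists f, [/\ M f,
    forall k, `|Defs.integral L eta (fun x => g k x * f x) -
                Defs.integral L mu (g k)| <= e * (2 * b) &
    forall k, P k -> Defs.integral L eta (fun x => g k x * f x) =
                     Defs.integral L mu (g k)].
Proof.
move=> Ximu ug Pg e0.
(* On P the approximant is g k itself, which turns the estimate into an equality. *)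
have /choice[h Hh] k : exists h, [/\ B0 L h, forall x, `|g k x - h x| <= e &
    P k -> h = g k].
  case Pk : (P k).
    exists (g k); split => //; first exact: Pg.
    by move=> x; rewrite subrr normr0 ltW.
  by have [h Bh gh] := ug k e e0; exists h.
have [|f Mf fh] := @exact_density mu K h Ximu; first by move=> k; case: (Hh k).
exists f; split => // k.
  case: (Hh k) => Bh gh _.
  by have := integral_density_dist Mf Ximu (ug k) Bh gh;
    rewrite fh subrr normr0 add0r.
move=> Pk; case: (Hh k) => Bh _ /(_ Pk) hg.
have [[mu_measure _] _] := Ximu; have [[Bf _] _] := Mf.
rewrite (integral_step x0 HL eta_measure); last by apply: B0M => //; exact: Pg.
rewrite (integral_step x0 HL mu_measure); last exact: Pg.
by have := fh k; rewrite hg.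
Qed.

End Controls.

(** * Limits of controls along ultrafilters *)

Lemma fmap_ultra (T U : Type) (f : T -> U) (F : set_system T) :
  UltraFilter F -> UltraFilter (f @ F).
Proof.
move=> FU; split; first exact: fmap_proper_filter.
move=> G GP FG; apply/seteqP; split => [A GA|//].
have [//|FcA] := in_ultra_setVsetC (f @^-1` A) FU.
have /FG GcA : (f @ F) (~` A) by [].
by case: (@filter_ex _ G _ (A `&` ~` A)); [exact: filterI|move=> y []].
Qed.

Section LimitControl.
Context {R : realType} {E : Type} (x0 : E).
Context (L : set (set E)) (HL : semialgebra L).
Context (eta : set E -> R) (eta_measure : nonneg_measure L eta).
Context (b : R).
Implicit Types (A : set E) (f g h w : E -> R) (mu : set E -> R).

Local Notation M := (ordinary_controls L eta b).
Local Notation Xi := (generalized_controls L eta b).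

Definition density_measure f A : R :=
  step_integral L eta (fun x => \1_A x * f x).

Lemma B0_indicM f A : B0 L f -> L A -> B0 L (fun x => \1_A x * f x).
Proof. by move=> Bf LA; apply: (B0M x0 HL) => //; exact: B0_indic. Qed.

(** As a finite combination of values on members of L, the integral passes to limits taken set by
    set. *)
Lemma step_integral_density f h (I : finType) (q : E -> I) (a : I -> R) :
  B0 L f -> block_map L q -> (forall x, h x = a (q x)) ->
  step_integral L eta (fun x => h x * f x) =
  block_sum (density_measure f) q a.
Proof.
move=> Bf Lq hE; rewrite /block_sum /density_measure.
rewrite -(step_integral_sum x0 HL eta_measure); last first.
  by move=> i; exact: B0_indicM.
apply: eq_step_integral => x; rewrite hE (bigD1 (q x)) //= big1 ?addr0.
  by rewrite indicE mem_set ?mul1r.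
by move=> i /eqP iq; rewrite indicE memNset ?mul0r ?mulr0// => qi; apply: iq.
Qed.

Lemma density_measure_ge0 f A : B0p L f -> L A -> 0 <= density_measure f A.
Proof.
move=> [Bf f0] LA.
rewrite -(mul0r (eta setT)) -(step_integral_cst x0 HL eta_measure).
apply: (le_step_integral x0 HL eta_measure); first exact: B0_cst.
  exact: B0_indicM.
by move=> x; rewrite mulr_ge0.
Qed.

Lemma density_measure_le f A : B0p L f -> L A ->
  density_measure f A <= step_integral L eta f.
Proof.
move=> [Bf f0] LA; apply: (le_step_integral x0 HL eta_measure) => //.
  exact: B0_indicM.
by move=> x; rewrite ler_piMl// indicE lern1 leq_b1.
Qed.

(** Pointwise, the indicators of the pieces add up to the indicator of A. *)
Lemma density_measure_additive f : B0 L f ->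
  finitely_additive L (density_measure f).
Proof.
move=> Bf A m F LA dF; have [m0 LF tF UF] := dF.
have := step_integral_sum x0 HL eta_measure (fun=> 1)
  (fun i => B0_indicM Bf (LF i)).
under [in X in _ = X -> _]eq_bigr do rewrite mul1r.
move=> <-; apply: eq_step_integral => x.
have [Ax|nAx] := pselect (A x); last first.
  rewrite indicE memNset// mul0r big1// => i _.
  rewrite indicE memNset ?mul0r ?mulr0// => Fx.
  by apply: nAx; rewrite -UF; exists i.
have : A x by []; rewrite -{1}UF => -[i _ Fx].
rewrite (bigD1 i)//= big1 ?addr0; last first.
  move=> j /eqP ji; rewrite indicE memNset ?mul0r ?mulr0// => Fjx; apply: ji.
  by apply: tF => //; exists x.
by rewrite !indicE !mem_set// !mul1r.
Qed.

Lemma density_measure_control f : M f -> Xi (density_measure f).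
Proof.
move=> [Bpf fb]; have [Bf f0] := Bpf.
split; [split; [split|]|].
- exact: density_measure_additive.
- by move=> A LA; exact: density_measure_ge0.
- move=> A LA etaA0; apply/eqP; rewrite eq_le density_measure_ge0// andbT.
  have [C C0 fC] := B0_bounded x0 Bf.
  have [m [F dF]] := semialgebraC HL LA.
  have [q [qF qN]] := disjoint_union_block_map dF.
  have Lq : block_map L q.
    by move=> [i|]; rewrite ?qF ?qN ?setCK//; case: dF.
  (* A is the block [None], so c is C times its indicator: it dominates f on A and integrates to C
     eta(A) = 0. *)
  pose c (o : option 'I_m) : R := if o is Some _ then 0 else C.
  have <- : step_integral L eta (fun x => c (q x)) = 0.
    rewrite (step_integralE x0 HL eta_measure Lq (a := c))//.
    rewrite /block_sum (bigD1 None)//= qN setCK etaA0 mulr0 add0r big1//.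
    by case=> // i _; rewrite mul0r.
  apply: (le_step_integral x0 HL eta_measure); first exact: B0_indicM.
    by apply/(B0P x0); exists (option 'I_m), q, c.
  move=> x; rewrite indicE /c; case qx : (q x) => [i|].
    rewrite memNset ?mul0r// => Ax.
    suff : (~` A) x by [].
    by case: dF => _ _ _ <-; exists i => //; rewrite -qF.
  rewrite mem_set ?mul1r; first exact: le_trans (ler_norm _) (fC x).
  by rewrite -(setCK A) -qN.
- rewrite -fb; apply: eq_step_integral => x.
  by rewrite indicE mem_set// mul1r.
Qed.

Lemma ultrafilter_limit_control (U : set_system (E -> R)) : UltraFilter U ->
  U M -> exists2 mu, Xi mu & forall g, uniformly_approximable L g ->
    Defs.integral L eta (fun x => g x * f x) @[f --> U] -->
    Defs.integral L mu g.
Proof.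
move=> UU UM.
(* Outside L this [lim] may be a default value; only members of L matter. *)
pose mu A : R := lim (density_measure f A @[f --> U]).
have mu_cvg A : L A -> density_measure f A @[f --> U] --> mu A.
  move=> LA.
  have Uv : U [set f | `[0, b]%classic (density_measure f A)].
    apply: filterS UM => f [Bf fb] /=.
    by rewrite in_itv/= density_measure_ge0//= -fb density_measure_le.
  have := @segment_compact R 0 b; rewrite compact_ultra.
  move=> /(_ _ (@fmap_ultra _ _ (density_measure ^~ A) U UU) Uv)[v [_ fv]].
  by apply/cvg_ex; exists v.
have Ximu : Xi mu.
  split; [split; [split|]|].
  - move=> A m F LA dF; have [m0 LF tF UF] := dF.
    apply: (cvg_unique _ (mu_cvg A LA)) => //=.
    have : \sum_(i < m) density_measure f (F i) @[f --> U] -->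
        \sum_(i < m) mu (F i).
      by apply: cvg_big => [|i _]; [exact: add_continuous|exact: mu_cvg].
    apply: cvg_trans; apply: near_eq_cvg; apply: filterS UM => f [[Bf _] _].
    by rewrite (density_measure_additive Bf LA dF).
  - move=> A LA; apply: limr_ge.
      by apply/cvg_ex; exists (mu A); exact: mu_cvg.
    by apply: filterS UM => f [Bf _]; exact: density_measure_ge0.
  - move=> A LA A0; apply: (cvg_unique _ (mu_cvg A LA)) => //=.
    apply: cvg_near_cst; apply: filterS UM => f.
    by move=> /density_measure_control[[_ H] _]; exact: H.
  - apply: (cvg_unique _ (mu_cvg setT (semialgebraT HL))) => //=.
    apply: cvg_near_cst; apply: filterS UM => f.
    by move=> /density_measure_control[].
exists mu => // g ug; apply/cvgrPdist_lt => e e0.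
have [[mu_measure _] mub] := Ximu.
have b0 : 0 <= b by rewrite -mub; apply: mu_measure.2; exact: semialgebraT HL.
have b1 : 0 < 2 * b + 1 by rewrite ltr_wpDl// mulr_ge0.
(* With this d, replacing g by h costs at most 2 b d <= e / 2; the other half is left for the
   convergence of the block sums. *)
have d0 : 0 < e / 2 / (2 * b + 1) by rewrite !divr_gt0.
have [h Bh gh] := ug _ d0.
have hb : e / 2 / (2 * b + 1) * (2 * b) <= e / 2.
  rewrite -mulrA ler_piMr ?divr_ge0 ?(ltW e0)//.
  by rewrite mulrC ler_pdivrMr// mul1r lerDl.
have [I [q [a [Lq hE]]]] := (B0P x0 L h).1 Bh.
have : block_sum (density_measure f) q a @[f --> U] --> block_sum mu q a.
  apply: cvg_big => [|i _]; first exact: add_continuous.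
  by apply: cvgM; [exact: cvg_cst|exact: mu_cvg].
move=> /cvgrPdist_lt /(_ (e / 2)).
rewrite divr_gt0// => /(_ isT) He.
near=> f.
have Mf : M f by near: f.
have := integral_density_dist x0 HL eta_measure Mf Ximu ug Bh gh.
rewrite (step_integral_density Mf.1.1 Lq hE).
rewrite (step_integralE x0 HL mu_measure Lq hE) => H1.
have : `|block_sum mu q a - block_sum (density_measure f) q a| < e / 2.
  by near: f.
by rewrite distrC => H2; rewrite distrC; lra.
Unshelve. all: end_near. Qed.

End LimitControl.

(** * Attraction sets and ultrafilters *)

Section Attraction.
Context {T : Type} {V : topologicalType} (M : set T) (Pi : T -> V).
Implicit Types X : set (set T).

Lemma tail_filter_proper (D : Type) (le : D -> D -> Prop) :
  directed_order le -> ProperFilter (tail_filter le).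
Proof.
case=> -[d0] refl trans ub; apply: filter_from_proper; last first.
  by move=> d _; exists d.
apply: filter_from_filter; first by exists d0.
move=> i j _ _; have [k [ik jk]] := ub i j; exists k => // d /= kd.
by split; [exact: trans kd|exact: trans kd].
Qed.

Lemma sub_attraction_set X1 X2 :
  (forall A, X2 A -> exists2 B, X1 B & B `<=` A) ->
  attraction_set M Pi X1 `<=` attraction_set M Pi X2.
Proof.
move=> X12 x [D [le [g [dle Mg Xg gx]]]]; exists D, le, g; split => // A.
by move=> /X12[B /Xg[d dB] BA]; exists d => d' /dB/BA.
Qed.

Lemma sub_sequential_attraction_set X1 X2 :
  (forall A, X2 A -> exists2 B, X1 B & B `<=` A) ->
  sequential_attraction_set M Pi X1 `<=` sequential_attraction_set M Pi X2.
Proof.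
move=> X12 x [g [Mg Xg gx]]; exists g; split => // A.
by move=> /X12[B /Xg[d dB] BA]; exists d => d' /dB/BA.
Qed.

Lemma sequential_attraction_set_sub X :
  sequential_attraction_set M Pi X `<=` attraction_set M Pi X.
Proof.
move=> x [f [Mf Xf fx]]; exists nat, (fun m k => (m <= k)%N), f; split => //.
split=> [|//|m k l|m k]; [exact: (inhabits 0%N)|exact: leq_trans|].
by exists (maxn m k); rewrite leq_maxl leq_maxr.
Qed.

(** The image of the tail filter under the net extends to an ultrafilter; eventual membership and
    convergence persist in a finer filter. *)
Lemma attraction_set_ultrafilter X x : attraction_set M Pi X x ->
  exists U : set_system T, [/\ UltraFilter U, U M, X `<=` U &
    Pi f @[f --> U] --> x].
Proof.
move=> [D [le [g [dle Mg Xg gx]]]].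
have PF := tail_filter_proper dle.
have [U [UU gU]] := ultraFilterLemma (fmap_proper_filter g PF).
exists U; split => //.
- by apply: gU; apply: (@filterS _ (tail_filter le) _ setT) => [d _|];
    [exact: Mg|exact: filterT].
- by move=> A /Xg[d dA]; apply: gU; exists d.
- by move=> A /gx gA; apply: gU.
Qed.

End Attraction.

(** * Relaxed constraints and closedness *)

Section Relaxation.
Context {R : realType} {N : nat}.
Implicit Types (Y : set 'rV[R]_N) (J : {set 'I_N}).

Lemma ONhat_sub_ON Y e J : 0 < e -> ONhat Y e J `<=` ON Y e.
Proof.
move=> e0 z [y [Yy yJ yNJ]]; exists y => //.
(* Positivity of e handles both the seed 0 of the maximum and the coordinates in J, where the
   difference is 0. *)
apply: bigmax_lt => // j _; have [jJ|jJ] := boolP (j \in J).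
  by rewrite yJ// subrr normr0.
exact: yNJ.
Qed.

Lemma relaxed_hat_refines (T : Type) (M : set T) (S : T -> 'rV[R]_N) Y J A :
  relaxed M S Y A -> exists2 B, relaxed_hat M S Y J B & B `<=` A.
Proof.
move=> [e e0 <-]; exists (M `&` S @^-1` ONhat Y e J); first by exists e.
by move=> f [Mf Sf]; split => //; exact: ONhat_sub_ON Sf.
Qed.

Lemma closed_ON_limit (T : Type) (U : set_system T) (S : T -> 'rV[R]_N) Y
    (y : 'rV[R]_N) : ProperFilter U -> closed Y ->
  (forall j, S f 0 j @[f --> U] --> y 0 j) ->
  (forall e, 0 < e -> U (S @^-1` ON Y e)) -> Y y.
Proof.
move=> PU cY Sy SY; apply: cY => B /nbhs_ballP[e /= e0 yB].
have e2 : 0 < e / 2 by rewrite divr_gt0.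
have Se : U [set f | forall j, `|y 0 j - S f 0 j| < e / 2].
  by apply: filter_forall => j; have /cvgrPdist_lt/(_ _ e2) := Sy j.
(* One f has its image within e / 2 of both y and some z in Y, so z lies in the e-ball around y. *)
have [f [[z Yz zf] yf]] := filter_ex (filterI (SY _ e2) Se).
exists z; split => //; apply: yB; split => // i j; rewrite ord1 /ball /=.
rewrite (splitr e) (le_lt_trans (ler_distD (S f 0 j) _ _))// ltrD//.
rewrite distrC (le_lt_trans _ zf)//.
exact: (le_bigmax _ (fun j => `|z 0 j - S f 0 j|)).
Qed.

End Relaxation.

(** * The cycle of inclusions between the attraction sets *)

Theorem mainTheorem1 (R : realType) (E : Type) (L : set (set E))
  (eta : set E -> R) (b : R) (n N : nat)
  (pi : 'I_n -> E -> R) (s : 'I_N -> E -> R)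
  (Y : set 'rV[R]_N) (J : {set 'I_N})
  (E_nonempty : inhabited E)
  (L_semialgebra : semialgebra L)
  (eta_measure : nonneg_measure L eta)
  (b_ge0 : 0 <= b)
  (n_gt0 : (0 < n)%N) (N_gt0 : (0 < N)%N)
  (pi_B : forall i, B L (pi i))
  (s_B : forall j, B L (s j))
  (Y_nonempty : Y !=set0)
  (s_B0 : forall j, j \in J -> B0 L (s j))
  (Y_closed : closed Y) :
  let M := ordinary_controls L eta b in
  let Xi := generalized_controls L eta b in
  let Pi := density_map L eta pi in
  let S := density_map L eta s in
  let tPi := measure_map L pi in
  let tS := measure_map L s in
  [/\ attraction_set M Pi (relaxed M S Y)
        = attraction_set M Pi (relaxed_hat M S Y J),
      attraction_set M Pi (relaxed_hat M S Y J)
        = sequential_attraction_set M Pi (relaxed M S Y),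
      sequential_attraction_set M Pi (relaxed M S Y)
        = sequential_attraction_set M Pi (relaxed_hat M S Y J) &
      sequential_attraction_set M Pi (relaxed_hat M S Y J)
        = tPi @` (Xi `&` tS @^-1` Y)].
Proof.
move=> M Xi Pi S tPi tS.
have [x0] := E_nonempty.
(* Nets with [relaxed] give the largest of the four sets, sequences with [relaxed_hat] the smallest;
   bounding the former by the target and the target by the latter closes the cycle. *)
have as_sub : attraction_set M Pi (relaxed M S Y) `<=`
    tPi @` (Xi `&` tS @^-1` Y).
  move=> x /attraction_set_ultrafilter[U [UU UM XU Pix]].
  have [mu Ximu mu_lim] := ultrafilter_limit_control x0 L_semialgebra
    eta_measure UU UM.
  exists mu.
    split => //; apply: (@closed_ON_limit _ _ _ U S) => //.
      move=> j; rewrite mxE; under eq_fun do rewrite mxE.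
      exact/mu_lim/B_uniformly_approximable.
    move=> e e0; have : relaxed M S Y (M `&` S @^-1` ON Y e) by exists e.
    by move=> /XU; apply: filterS => f [].
  apply/rowP => i; rewrite mxE.
  (* Coordinate i of [Pi f] converges along U both to the integral of [pi i] against mu and to that
     coordinate of x. *)
  have /cvg_unique : ProperFilter (Pi f 0 i @[f --> U]).
    exact: fmap_proper_filter.
  apply=> //=.
    under eq_fun do rewrite mxE.
    exact/mu_lim/B_uniformly_approximable.
  exact: (cvg_comp Pi (fun z : 'rV[R]_n => z 0 i) Pix
    (@coord_continuous _ _ _ 0 i x)).
have sub_sas : tPi @` (Xi `&` tS @^-1` Y) `<=`
    sequential_attraction_set M Pi (relaxed_hat M S Y J).
  move=> _ [mu [Ximu YSmu] <-].
  (* Joining both families lets a single control approximate all the integrals, exactly on the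
     indices of J. *)
  pose g (k : 'I_n + 'I_N) := match k with inl i => pi i | inr j => s j end.
  pose P (k : 'I_n + 'I_N) := if k is inr j then j \in J else false.
  have ug k : uniformly_approximable L (g k).
    by apply: B_uniformly_approximable; case: k => i; [exact: pi_B|exact: s_B].
  have Pg k : P k -> B0 L (g k) by case: k => // j; exact: s_B0.
  have m_gt0 (m : nat) : 0 < m.+1%:R^-1 :> R by rewrite invr_gt0.
  have /choice[f_ Hf] m := approximate_density x0 L_semialgebra eta_measure
    Ximu ug Pg (m_gt0 m).
  have lim e : 0 < e -> \forall m \near \oo, forall k,
      `|Defs.integral L eta (fun x => g k x * f_ m x) -
        Defs.integral L mu (g k)| < e.
    (* The error at index m is at most 2 b / (m + 1); enlarging 2 b to 2 b + 1 allows the division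
       even when b = 0. *)
    move=> e0; have b1 : 0 < 2 * b + 1 by rewrite ltr_wpDl// mulr_ge0.
    near=> m => k.
    have [_ /(_ k) H _] := Hf m; apply: (le_lt_trans H).
    have m_small : m.+1%:R^-1 < e / (2 * b + 1).
      near: m; exact: near_infty_natSinv_lt (PosNum (divr_gt0 e0 b1)).
    rewrite (@le_lt_trans _ _ (m.+1%:R^-1 * (2 * b + 1)))//.
      by rewrite ler_wpM2l ?invr_ge0// lerDl.
    by rewrite -ltr_pdivlMr.
  exists f_; split.
  - by move=> m; case: (Hf m).
  - move=> _ [e /= e0 <-]; have [m _ Hm] := lim e e0.
    exists m => k mk; split; first by case: (Hf k).
    (* The same point of Y, the moment vector of mu, witnesses every relaxation. *)
    exists (tS mu); split => // j; rewrite !mxE.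
      by move=> jJ; have [_ _ /(_ (inr j) jJ)] := Hf k.
    by move=> _; rewrite distrC; exact: (Hm k mk (inr j)).
  - apply/cvg_ballP => e e0; have := lim e e0; apply: filterS => m Hm.
    split => // i j; rewrite ord1 !mxE /ball /= distrC.
    exact: (Hm (inl j)).
have hat_sub : attraction_set M Pi (relaxed_hat M S Y J) `<=`
    attraction_set M Pi (relaxed M S Y).
  by apply: sub_attraction_set => A; exact: relaxed_hat_refines.
have hat_sub_seq : sequential_attraction_set M Pi (relaxed_hat M S Y J) `<=`
    sequential_attraction_set M Pi (relaxed M S Y).
  by apply: sub_sequential_attraction_set => A; exact: relaxed_hat_refines.
have seq_sub := @sequential_attraction_set_sub _ _ M Pi.
have -> : attraction_set M Pi (relaxed M S Y) = tPi @` (Xi `&` tS @^-1` Y).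
  apply/seteqP; split => // x /sub_sas/hat_sub_seq; exact: seq_sub.
have -> : attraction_set M Pi (relaxed_hat M S Y J) =
    tPi @` (Xi `&` tS @^-1` Y).
  apply/seteqP; split => [x /hat_sub/as_sub//|x /sub_sas]; exact: seq_sub.
have -> : sequential_attraction_set M Pi (relaxed M S Y) =
    tPi @` (Xi `&` tS @^-1` Y).
  by apply/seteqP; split => [x /seq_sub/as_sub//|x /sub_sas/hat_sub_seq].
have -> // : sequential_attraction_set M Pi (relaxed_hat M S Y J) =
    tPi @` (Xi `&` tS @^-1` Y).
by apply/seteqP; split => [x /hat_sub_seq/seq_sub/as_sub|].
Unshelve. all: end_near. Qed.
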